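(* The property ČF$T_0$ is preserved under ČF-homeomorphisms: if $\theta:(X,c)\to(Y,d)$ is a ČF-homeomorphism between fuzzy closure spaces and $(X,c)$ is ČF$T_0$, then $(Y,d)$ is ČF$T_0$.
   Context: $I=[0,1]$; a fuzzy (sub)set of a non-empty set $X$ is a map $f:X\to I$, and $I^X$ is the set of all of them, ordered pointwise, with $\vee,\wedge$ pointwise supremum/infimum. $\underline 0$ is the constant $0$ fuzzy set; the complement is $\mathfrak{Co}(f)(x)=1-f(x)$. For $x\in X$ and $0<\lambda\le1$, the fuzzy point $x_\lambda$ has value $\lambda$ at $x$ and $0$ elsewhere; $x_\lambda\in f$ means $x_\lambda\le f$, i.e. $\lambda\le f(x)$. Fuzzy points $x_\lambda,y_\gamma$ are distinct if $x\ne y$. A fuzzy closure space is a pair $(X,c)$ with $X$ a non-empty set and $c:I^X\to I^X$ satisfying $c(\underline 0)=\underline 0$, $f\le c(f)$, and $c(f\vee g)=c(f)\vee c(g)$ for all $f,g\in I^X$ (idempotency is not required). For $\theta:X\to Y$ and $f\in I^X$, $\theta(f)(y)=\sup\{f(x):\theta(x)=y\}$ if $\theta^{-1}(y)\ne\emptyset$, and $0$ otherwise. $\theta:(X,c)\to(Y,d)$ is ČF-continuous if $\theta(c(f))\le d(\theta(f))$ for all $f\in I^X$; it is a ČF-homeomorphism if it is bijective and both $\theta$ and $\theta^{-1}$ are ČF-continuous. $(X,c)$ is ČF$T_0$ if for every two distinct fuzzy points $x_\lambda,y_\gamma$ of $X$, either $x_\lambda\in\mathfrak{Co}(c(y_\gamma))$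 or $y_\gamma\in\mathfrak{Co}(c(x_\lambda))$. *)

(* Defs.v *)
From mathcomp Require Import all_boot all_order all_algebra.
From mathcomp Require Import interval_inference.
From mathcomp Require Import all_classical all_reals.

Set Implicit Arguments.
Unset Strict Implicit.
Unset Printing Implicit Defensive.

Import Order.TTheory GRing.Theory Num.Theory.

Local Open Scope classical_set_scope.
Local Open Scope ring_scope.

(* The pointwise order and lattice structure on fuzzy X R are the ones the
   library puts on functions into a lattice: f <= g, f `|` g in order_scope. *)
Notation fuzzy X R := (X -> {i01 R})%type.

Definition fuzzy0 (R : realType) (X : Type) : fuzzy X R := fun=> 0%:i01.

Definition fuzzyC (R : realType) (X : Type) (f : fuzzy X R) : fuzzy X R :=
  fun x => (1 - (f x)%:num)%:i01.

(* The fuzzy point x_l; a genuine fuzzy point only when 0 < l. *)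
Definition fpoint (R : realType) (X : Type) (x : X) (l : {i01 R}) :
    fuzzy X R :=
  fun z => if `[< z = x >] then l else 0%:i01.

Definition fpoint_in (R : realType) (X : Type) (x : X) (l : {i01 R})
    (f : fuzzy X R) : Prop :=
  (fpoint x l <= f)%O.

Section FuzzyImage.
Context {R : realType} {X Y : Type}.
Variables (theta : X -> Y) (f : fuzzy X R) (y : Y).

Definition fuzzy_image_val : R :=
  if `[< exists x, theta x = y >]
  then sup [set (f x)%:num | x in [set x | theta x = y]]
  else 0.

Let values_le1 :
  ubound [set (f x)%:num | x in [set x | theta x = y]] (1 : R).
Proof. by move=> _ [x _ <-]. Qed.

Lemma fuzzy_image_val_ge0 : 0 <= fuzzy_image_val.
Proof.
rewrite /fuzzy_image_val; case: asboolP => // -[x xy].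
apply: (@le_trans _ _ (f x)%:num) => //; apply: ub_le_sup; last by exists x.
by exists 1.
Qed.

Lemma fuzzy_image_val_le1 : fuzzy_image_val <= 1.
Proof.
rewrite /fuzzy_image_val; case: asboolP => // -[x xy].
by apply: ge_sup => //; exists (f x)%:num, x.
Qed.

End FuzzyImage.

Definition fuzzy_image (R : realType) (X Y : Type) (theta : X -> Y)
    (f : fuzzy X R) : fuzzy Y R :=
  fun y => Itv01 (fuzzy_image_val_ge0 theta f y) (fuzzy_image_val_le1 theta f y).

Record fuzzyClosureSpace (R : realType) := FuzzyClosureSpace {
  fcs_carrier :> Type;
  fcs_nonempty : inhabited fcs_carrier;
  fcl : fuzzy fcs_carrier R -> fuzzy fcs_carrier R;
  fcl0 : fcl (@fuzzy0 R fcs_carrier) = @fuzzy0 R fcs_carrier;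
  fcl_ge : forall f : fuzzy fcs_carrier R, (f <= fcl f)%O;
  fclU : forall f g : fuzzy fcs_carrier R,
    fcl (f `|` g)%O = (fcl f `|` fcl g)%O }.

Definition CF_continuous (R : realType) (X Y : fuzzyClosureSpace R)
    (theta : X -> Y) : Prop :=
  forall f : fuzzy X R,
    (fuzzy_image theta (fcl f) <= fcl (fuzzy_image theta f))%O.

Definition CF_homeomorphism (R : realType) (X Y : fuzzyClosureSpace R)
    (theta : X -> Y) : Prop :=
  exists theta_inv : Y -> X,
    [/\ cancel theta theta_inv, cancel theta_inv theta,
        CF_continuous theta & CF_continuous theta_inv].

Definition CF_T0 (R : realType) (X : fuzzyClosureSpace R) : Prop :=
  forall (x y : X) (l m : {i01 R}),
    0 < l%:num -> 0 < m%:num -> x <> y ->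
    fpoint_in x l (fuzzyC (fcl (fpoint y m))) \/
    fpoint_in y m (fuzzyC (fcl (fpoint x l))).

(* Main.v *)
(* For a bijection theta the Zadeh image of f is f o theta^-1, so continuity of
   theta^-1 bounds d(y_m) by c((theta^-1 y)_m) o theta^-1. Complementation
   reverses this bound, which transports the separation from X to Y. *)
Require Import Defs.
From mathcomp Require Import all_boot all_order all_algebra.
From mathcomp Require Import interval_inference.
From mathcomp Require Import all_classical all_reals.

Set Implicit Arguments.
Unset Strict Implicit.
Unset Printing Implicit Defensive.

Import Order.TTheory GRing.Theory Num.Theory.

Local Open Scope classical_set_scope.
Local Open Scope ring_scope.

Lemma fpoint_inE (R : realType) (X : Type) (x : X) (l : {i01 R})
    (f : fuzzy X R) : fpoint_in x l f <-> l%:num <= (f x)%:num.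
Proof.
rewrite /fpoint_in; split => [/lefP/(_ x)|lf].
  by rewrite /fpoint; case: asboolP.
apply/lefP => z; rewrite /fpoint; case: asboolP => [->//|_].
by rewrite -num_le /=.
Qed.

(** The fibre of [g] over [y] is the singleton of [h y], so the supremum runs over one value and the
    default 0 never occurs. *)
Lemma fuzzy_image_bij (R : realType) (X Y : Type) (g : X -> Y) (h : Y -> X)
    (f : fuzzy X R) :
  cancel g h -> cancel h g -> fuzzy_image g f = f \o h.
Proof.
move=> gK hK; apply/funext => y; apply/val_inj => /=.
rewrite /fuzzy_image_val; case: asboolP => [_|[]]; last by exists (h y).
rewrite (_ : [set x | g x = y] = [set h y]); first by rewrite image_set1 sup1.
by apply/seteqP; split => x /=; [move=> <-|move=> ->].
Qed.

(** With [fuzzy_image_bij], this makes the image of a fuzzy point under [h] a fuzzy point of the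
    same height. *)
Lemma fpoint_comp (R : realType) (X Y : Type) (g : X -> Y) (h : Y -> X) (y : Y)
    (l : {i01 R}) :
  cancel g h -> cancel h g -> fpoint y l \o g = fpoint (h y) l.
Proof.
move=> gK hK; apply/funext => x; rewrite /fpoint /=.
by congr (if _ then _ else _); apply: asbool_equiv_eq; split => [<-|->].
Qed.

Theorem theorem4p2 (R : realType) (X Y : fuzzyClosureSpace R) (theta : X -> Y)
    (theta_homeo : CF_homeomorphism theta) (X_T0 : CF_T0 X) : CF_T0 Y.
Proof.
have [h [gK hK _ h_cont]] := theta_homeo.
(* Stated for an arbitrary pair, so that it serves both disjuncts of the separation. *)
have separated y y' l m :
    fpoint_in (h y) l (fuzzyC (fcl (fpoint (h y') m))) ->
    fpoint_in y l (fuzzyC (fcl (fpoint y' m))).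
  move=> /fpoint_inE /= le_l; apply/fpoint_inE => /=.
  apply: le_trans le_l _; rewrite lerD2l lerN2 num_le.
  (* Evaluation at [h y] is the right choice: the image under [h] is composition with [theta], and
     [theta (h y) = y]. *)
  have /lefP/(_ (h y)) := h_cont (fpoint y' m).
  by rewrite !(fuzzy_image_bij _ hK gK) (fpoint_comp _ _ gK hK) /= hK.
move=> y y' l m l_gt0 m_gt0 yy'.
have hyy' : h y <> h y' by move/(can_inj hK).
by case: (X_T0 _ _ _ _ l_gt0 m_gt0 hyy') => /separated; [left|right].
Qed.
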